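(* Let $R$ be the endomorphism ring of an elliptic curve. If $g\in SL(2,R)$ is of finite order $r$, then the trace $\mathrm{tr}(g)\in\{\pm2,\pm1,0\}$. The eigenvalues $\lambda_1,\lambda_2$ of $g$ are of orders $r_1=r_2=r\in\{1,2,3,4,6\}$. More precisely (up to a transposition of $\lambda_1,\lambda_2$): (i) $\mathrm{tr}(g)=2$ or, equivalently, $\lambda_1=\lambda_2=1$, $g=I_2$, if and only if $g$ is of order $1$; (ii) $\mathrm{tr}(g)=-2$ or, equivalently, $\lambda_1=\lambda_2=-1$, $g=-I_2$, if and only if $g$ is of order $2$; (iii) $\mathrm{tr}(g)=1$ or, equivalently, $\lambda_1=e^{\frac{\pi i}{3}}$, $\lambda_2=e^{-\frac{\pi i}{3}}$, if and only if $g$ is of order $6$; (iv) $\mathrm{tr}(g)=-1$ or, equivalently, $\lambda_1=e^{\frac{2\pi i}{3}}$, $\lambda_2=e^{-\frac{2\pi i}{3}}$, if and only if $g$ is of order $3$; (v) $\mathrm{tr}(g)=0$ or, equivalently, $\lambda_1=i$, $\lambda_2=-i$, if and only if $g$ is of order $4$.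
   Context: $R=\mathrm{End}(E)$ for a complex elliptic curve $E$; thus $R=\mathbb{Z}$ or $R=\mathbb{Z}+f\mathcal{O}_{-d}$ for some $f\in\mathbb{N}$ and the integers ring $\mathcal{O}_{-d}$ of an imaginary quadratic number field $\mathbb{Q}(\sqrt{-d})$, regarded as a subring of $\mathbb{C}$. $SL(2,R)=\{g\in R_{2\times2}:\det(g)=1\}$. The order of an eigenvalue is its order as an element of $\mathbb{C}^*$. *)

(* Defs.v *)
From HB Require Import structures.
From mathcomp Require Import all_boot all_order all_algebra.
From mathcomp Require Import all_classical all_reals all_analysis.
From mathcomp Require Import complex.

Set Implicit Arguments.
Unset Strict Implicit.
Unset Printing Implicit Defensive.

Import Order.TTheory GRing.Theory Num.Theory.
Import numFieldNormedType.Exports.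

Local Open Scope classical_set_scope.
Local Open Scope ring_scope.
Local Open Scope complex_scope.

(* The complex numbers are R[i] for R : realType. *)

Definition is_lattice (R : realType) (L : set R[i]) : Prop :=
  exists w1 w2 : R[i],
    (forall a b : R, a%:C * w1 + b%:C * w2 = 0 -> a = 0 /\ b = 0) /\
    L = [set z | exists m n : int, z = m%:~R * w1 + n%:~R * w2].

(* A complex elliptic curve is E = C / L with L a lattice.  An endomorphism of
   E (a holomorphic group homomorphism C / L -> C / L) is given by a
   holomorphic lift f : C -> C to the universal cover; the first two conditions
   say that f induces a well-defined homomorphism of C / L.  As the scalars of
   R[i]^o are R[i], derivable means complex differentiable.  Lifts of the same
   endomorphism differ by a constant in L. *)
Definition lifts_endomorphism (R : realType) (L : set R[i])
    (f : R[i]^o -> R[i]^o) : Prop :=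
  [/\ forall z l, L l -> L (f (z + l) - f z),
      forall z w, L (f (z + w) - (f z + f w))
    & forall z : R[i]^o, derivable f z 1].

(* End(C / L) as a subring of C: an endomorphism is identified with its
   differential at the origin, i.e. with the complex number by which it
   multiplies the tangent space. *)
Definition End_ring (R : realType) (L : set R[i]) : set R[i] :=
  [set a | exists f : R[i]^o -> R[i]^o,
     lifts_endomorphism L f /\ derive1 f 0 = a].

Definition is_elliptic_End_ring (R : realType) (S : set R[i]) : Prop :=
  exists L : set R[i], is_lattice L /\ S = End_ring L.

Definition SL2 (R : realType) (S : set R[i]) : set 'M[R[i]]_2 :=
  [set g : 'M[R[i]]_2 | (forall i j, S (g i j)) /\ \det g = 1].

(* x has order n: n is the least positive integer with x ^+ n = 1.  The library
   predicate makes sense in any nonzero ring, in particular for matrices. *)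
Definition has_order (A : nzRingType) (x : A) (n : nat) : Prop :=
  n.-primitive_root x.

(* Eigenvalues are counted with their algebraic multiplicities. *)
Definition eigenvalues2 (R : realType) (g : 'M[R[i]]_2) (l1 l2 : R[i]) : Prop :=
  char_poly g = ('X - l1%:P) * ('X - l2%:P).

(* e ^ (i t) for real t *)
Definition cexpi (R : realType) (t : R) : R[i] := cos t +i* sin t.

Definition eq_up_to_swap (T : Type) (x1 x2 y1 y2 : T) : Prop :=
  (x1 = y1 /\ x2 = y2) \/ (x1 = y2 /\ x2 = y1).

(* Main.v *)
Require Import Defs.
From HB Require Import structures.
From mathcomp Require Import all_boot all_order all_algebra.
From mathcomp Require Import all_classical all_reals all_analysis.
From mathcomp Require Import complex.
From mathcomp Require Import ring lra zify.

Set Implicit Arguments.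
Unset Strict Implicit.
Unset Printing Implicit Defensive.

Import Order.TTheory GRing.Theory Num.Theory.
Import numFieldNormedType.Exports.

Local Open Scope classical_set_scope.
Local Open Scope ring_scope.
Local Open Scope complex_scope.

(** The argument has an analytic half and an algebraic half, which meet in the
    trace.

    Analytic half: a real number in the endomorphism ring of C / L is an
    integer.  Let f be the lift of an endomorphism.  For fixed y the map
    z |-> f (z + y) - (f z + f y) is continuous with values in the discrete set
    L, hence constant ([lattice_valued_continuous_const]), so h = f - f 0 is
    additive.  An additive map differentiable at 0 is multiplication by its
    derivative ([additive_derivative_linear]), so each element of the
    endomorphism ring multiplies L into itself
    ([End_ring_preserves_lattice]).  If moreover the multiplier is real, its
    effect on a basis vector of L exhibits it as an integer coordinate
    ([real_multiplier_int]).

    Algebraic half: let g have determinant 1 and finite order r.  Its eigenvalues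
    are r-th roots of unity with product 1, hence conjugate to each other, and
    the trace is a real number in [-2, 2] ([inverse_root_of_unity_sum]).  It
    also multiplies L into itself, so it is one of the integers 2, -2, 1, -1, 0.
    Finally g, l1 and l2 all satisfy the same equation x ^+ 2 + 1 = t *: x, where
    t is the trace.  In a torsion-free algebra, be it the complex numbers or the
    2 x 2 matrices, this equation together with finiteness of the order
    determines the order of x
    ([primitive_root_of_trace]): for t = 1, -1, 0 the polynomial
    'X^2 - t 'X + 1 is the cyclotomic polynomial of index 6, 3, 4, and for
    t = 2, -2 the element x or - x is unipotent, hence 1.  Since
    distinct traces give distinct orders, every equivalence follows; the
    eigenvalues themselves are recovered from their sum and product. *)

(** * Real endomorphisms of an elliptic curve *)

Lemma int_valued_continuous_const (R : realType) (f : R -> R) :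
  continuous f -> (forall x, f x \is a Num.int) -> forall x y, f x = f y.
Proof.
move=> cf fint x y; wlog xy : x y / x <= y.
  by move=> H; case: (leP x y) => [|/ltW] /H.
apply/eqP/negPn/negP => ne.
pose m := Num.min (f x) (f y).
have mint : m \is a Num.int by rewrite /m minEle; case: ifP.
have mlt : m + 1 <= Num.max (f x) (f y).
  have : m < Num.max (f x) (f y) by rewrite /m gt_min !lt_max !ltxx /= orbF; case: ltgtP ne.
  have : Num.max (f x) (f y) \is a Num.int by rewrite maxEle; case: ifP.
  move: mint (Num.max _ _) => /intrP[a ->] _ /intrP[b ->].
  by rewrite ltr_int -[1]/(1%:~R) -intrD ler_int lezD1.
(* An intermediate value half-way between two consecutive integers. *)
have [] := @IVT R f x y (m + 2^-1) xy.
- by apply: continuous_subspaceT.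
- by rewrite -/m; apply/andP; split; lra.
move=> c _ fc; have := fint c; rewrite fc.
move: mint => /intrP[a ->] /intrP[b /eqP].
have -> : (a%:~R + 2^-1 == b%:~R :> R) = ((2 * a + 1)%:~R == (2 * b)%:~R :> R).
  rewrite intrD !intrM; apply/eqP/eqP => h; lra.
by rewrite eqr_int => /eqP h; lia.
Qed.

Section EndomorphismRing.
Context (R : realType).
Local Notation C := (R[i]^o).

Lemma continuous_real_complex : continuous (fun t : R => (t%:C : C)).
Proof.
move=> x; apply/cvgrPdist_lt => e e0.
have e1 : 0 < complex.Re e by move: e0; rewrite ltcE /= => /andP[].
have eE : e = (complex.Re e)%:C.
  by case: e e0 {e1} => a b; rewrite ltcE /= => /andP[/eqP ->].
near=> y.
rewrite -rmorphB normc_def /= expr0n addr0 sqrtr_sqr eE ltcR.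
near: y; exact: (nbhs_ball_norm x (PosNum e1)).
Unshelve. all: by end_near. Qed.

Lemma continuous_Re : continuous (fun z : C => complex.Re z : R).
Proof.
move=> x; apply/(@cvgrPdist_lt _ _ _ (nbhs x)) => e e0.
have e1 : 0 < e%:C by rewrite ltcR.
near=> y.
rewrite -ltcR; apply: (@le_lt_trans _ _ `|x - y|).
  by apply: le_trans (normc_ge_Re _); rewrite raddfB.
near: y; exact: (nbhs_ball_norm x (PosNum e1)).
Unshelve. all: by end_near. Qed.

Lemma continuous_Im : continuous (fun z : C => complex.Im z : R).
Proof.
have -> : (fun z : C => complex.Im z : R) =
          (fun z : C => complex.Re (- 'i * z : R[i])).
  by apply/funext => -[a b] /=; ring.
move=> x; apply: (continuous_comp (f := fun z : C => (- 'i * z : C))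
                                  (g := fun z : C => complex.Re z)).
  exact: mulrl_continuous.
exact: continuous_Re.
Qed.

(** The area form of the plane: [cross z w2 / cross w1 w2] is the coordinate of
    z along w1 in the basis (w1, w2). *)
Definition cross (z w : R[i]) : R :=
  complex.Re z * complex.Im w - complex.Im z * complex.Re w.

Lemma cross_basis_neq0 (w1 w2 : R[i]) :
  (forall a b : R, a%:C * w1 + b%:C * w2 = 0 -> a = 0 /\ b = 0) ->
  cross w1 w2 != 0.
Proof.
case: w1 w2 => [a b] [c d] ind; apply/eqP; rewrite /cross /= => D0.
(* If the area vanishes, c w1 - a w2 and d w1 - b w2 are null combinations. *)
have [] := ind c (- a).
  by apply/eqP; rewrite eq_complex /=; apply/andP; split; apply/eqP; lra.
have [] := ind d (- b).
  by apply/eqP; rewrite eq_complex /=; apply/andP; split; apply/eqP; lra.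
move=> d0 /eqP; rewrite oppr_eq0 => /eqP b0 c0 /eqP; rewrite oppr_eq0 => /eqP a0.
have [] := ind 1 1; last by move/eqP; rewrite oner_eq0.
by rewrite a0 b0 c0 d0 complexr0 !mulr0 addr0.
Qed.

Lemma crossC z w : cross w z = - cross z w.
Proof. by rewrite /cross; ring. Qed.

Lemma cross_lattice_point (m n : int) w1 w2 :
  cross (m%:~R * w1 + n%:~R * w2) w2 = m%:~R * cross w1 w2.
Proof.
rewrite -!(rmorph_int (real_complex R)).
by case: w1 w2 => [a b] [c d]; rewrite /cross /=; ring.
Qed.

Lemma continuous_cross w : continuous (fun z : C => cross z w : R).
Proof.
move=> x; rewrite /cross; apply: (@cvgB _ _ _ (nbhs x)).
  apply: (@cvgMl _ _ (nbhs x)); exact: continuous_Re.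
apply: (@cvgMl _ _ (nbhs x)); exact: continuous_Im.
Qed.

(** A lattice is discrete and the plane is connected.  Concretely, along a
    segment the two coordinates of phi in a basis of the lattice are continuous
    integer-valued functions of a real variable. *)
Lemma lattice_valued_continuous_const (L : set R[i]) (phi : C -> C) :
  is_lattice L -> continuous phi -> (forall z, L (phi z)) ->
  forall z w, phi z = phi w.
Proof.
move=> [w1 [w2 [ind LE]]] cphi Lphi z w.
have D0 := cross_basis_neq0 ind.
pose path (t : R) : C := phi (w + t%:C * (z - w)).
have cpath : continuous path.
  move=> t; apply: (@continuous_comp _ _ _ (fun t : R => w + t%:C * (z - w) : C) phi);
    last exact: cphi.
  apply: cvgD; first exact: cvg_cst.
  by apply: cvgMl; exact: continuous_real_complex.
have crossE w' : (forall z, L z -> cross z w' / cross w1 w2 \is a Num.int) ->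
   cross (path 1) w' = cross (path 0) w'.
  move=> hint; suff: cross (path 1) w' / cross w1 w2 = cross (path 0) w' / cross w1 w2.
    by apply: mulIf; rewrite invr_eq0.
  apply: (@int_valued_continuous_const _ (fun t => cross (path t) w' / cross w1 w2)).
    move=> t; apply: cvgMl.
    apply: (@continuous_comp _ _ _ path (fun z : C => cross z w')); first exact: cpath.
    exact: continuous_cross.
  by move=> t; apply: hint; exact: Lphi.
have p1 : path 1 = phi z by rewrite /path mul1r addrC subrK.
have p0 : path 0 = phi w by rewrite /path mul0r addr0.
have e2 := crossE w2; have e1 := crossE w1.
have {}e2 : cross (phi z) w2 = cross (phi w) w2.
  rewrite -p1 -p0; apply: e2 => u; rewrite LE => -[m [n ->]].
  by rewrite cross_lattice_point mulfK.
have {}e1 : cross (phi z) w1 = cross (phi w) w1.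
  rewrite -p1 -p0; apply: e1 => u; rewrite LE => -[m [n ->]].
  by rewrite addrC cross_lattice_point crossC mulrN mulNr mulfK// -mulrNz.
have := Lphi z; have := Lphi w; rewrite LE => -[m [n we]] [p [q ze]].
have D1 : cross w2 w1 != 0 by rewrite crossC oppr_eq0.
rewrite we ze cross_lattice_point cross_lattice_point in e2; move/(mulIf D0)/intr_inj: e2 => e2.
rewrite we ze addrC cross_lattice_point addrC cross_lattice_point in e1; move/(mulIf D1)/intr_inj: e1 => e1.
by rewrite we ze e1 e2.
Qed.

(** Along the sequence z / n, which tends to 0, the difference quotient of an
    additive h keeps the value h z / z. *)
Lemma additive_derivative_linear (h : C -> C) (a : C) :
  {morph h : x y / x + y} ->
  t^-1 *: h t @[t --> 0^'] --> a ->
  forall z, h z = a * z.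
Proof.
move=> hD ha z.
have h0 : h 0 = 0 by apply: (addrI (h 0)); rewrite -hD !addr0.
have [->|z0] := eqVneq z 0; first by rewrite h0 mulr0.
have hM n x : h (x *+ n) = h x *+ n.
  by elim: n => [|n IH]; rewrite ?mulr0n// !mulrS hD IH.
pose u (n : nat) : C := (harmonic n : R)%:C * z.
have uN n : u n *+ n.+1 = z.
  by rewrite /u -mulrnAl -rmorphMn /= -mulr_natr mulVf ?pnatr_eq0// mul1r.
have u0 n : u n != 0 by apply: contra_neq z0 => un0; rewrite -(uN n) un0 mul0rn.
have cu : u n @[n --> \oo] --> (0 : C).
  rewrite -[0](mul0r z); apply: cvgMl.
  exact: (cvg_comp _ _ (@cvg_harmonic R) (@continuous_real_complex 0)).
have cu' : u n @[n --> \oo] --> (0 : C)^'.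
  move=> P P0; have := cu _ P0; rewrite nbhs_simpl.
  by apply: (@filterS _ (\oo : set_system nat)) => n /=; apply; exact: u0.
have e : (fun n => (u n)^-1 *: h (u n)) = fun=> (z^-1 * h z : C).
  apply/funext => n; rewrite -{1 2}(uN n) hM -mulr_natr -[h _ *+ _]mulr_natr.
  have := u0 n; have : n.+1%:R != 0 :> C by rewrite pnatr_eq0.
  rewrite /GRing.scale /= => n1 un; field.
  by rewrite -mulrS n1 un.
have : (fun n => (u n)^-1 *: h (u n)) @ \oo --> a := cvg_comp _ _ cu' ha.
rewrite e => az; rewrite (cvg_unique (@norm_hausdorff _ _) az (@cvg_cst _ _ _ _ _)).
by rewrite mulrC mulrA mulfV// mul1r.
Qed.

(** The lift f minus its value at 0 is multiplication by the derivative, and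
    f (0 + l) - f 0 lies in L because f descends to the quotient. *)
Lemma End_ring_preserves_lattice (L : set R[i]) a l :
  is_lattice L -> End_ring L a -> L l -> L (a * l).
Proof.
move=> latL [f [[fL fD df] <-]] Ll.
have cf : continuous f.
  by move=> z; apply: differentiable_continuous; apply/derivable1_diffP; exact: df.
pose h z := f z - f 0.
have hD : {morph h : x y / x + y}.
  move=> x y; pose phi (z : C) : C := f (z + y) - (f z + f y).
  have : phi x = phi 0.
    apply: (lattice_valued_continuous_const latL) => [z|z]; last exact: fD.
    apply: (@cvgB _ _ _ (nbhs z)).
      apply: (@continuous_comp _ _ _ (fun z : C => z + y : C) f); last exact: cf.
      by apply: (@cvgD _ _ _ (nbhs z)); [exact: cvg_id | exact: cvg_cst].
    by apply: (@cvgD _ _ _ (nbhs z)); [exact: cf | exact: cvg_cst].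
  rewrite /phi /h add0r => e.
  rewrite -[f (x + y)](subrK (f x + f y)) e; ring.
rewrite -(@additive_derivative_linear h (derive1 f 0) hD).
  by rewrite /h -{1}[l]add0r; exact: fL.
rewrite derive1E.
have -> : (fun t : C => t^-1 *: h t) =
          (fun t : C => t^-1 *: ((f \o shift 0) (t *: (1 : C)) - f 0)).
  by apply/funext => t; rewrite /h /shift /comp addr0 [t *: 1]mulr1.
exact: df.
Qed.

Lemma is_lattice_add (L : set R[i]) u v : is_lattice L -> L u -> L v -> L (u + v).
Proof.
move=> [w1 [w2 [_ ->]]] [m [n ->]] [p [q ->]]; exists (m + p), (n + q).
by rewrite !intrD !mulrDl addrACA.
Qed.

(** The multiplier is the first coordinate of [c * w1] in the basis (w1, w2),
    because the basis is free over the real numbers. *)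
Lemma real_multiplier_int (L : set R[i]) (c : R) :
  is_lattice L -> (forall l, L l -> L (c%:C * l)) -> c \is a Num.int.
Proof.
move=> [w1 [w2 [ind LE]]] /(_ w1); rewrite LE => -[].
  by exists 1, 0; rewrite mul1r mul0r addr0.
move=> m [n e]; have [] := ind (c - m%:~R) (- n%:~R).
  rewrite rmorphB rmorphN !rmorph_int mulrBl e; ring.
by move=> /subr0_eq -> _.
Qed.
End EndomorphismRing.

(** * Elements of finite order with a given trace *)

Lemma primitive_root_least (A : nzRingType) (x : A) n : (0 < n)%N -> x ^+ n = 1 ->
  (forall d, (d %| n)%N -> (d < n)%N -> x ^+ d != 1) -> n.-primitive_root x.
Proof.
move=> n0 xn1 H; have [m mx mn] := prim_order_exists n0 xn1.
suff -> : n = m by [].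
apply/eqP; rewrite eq_sym eqn_leq dvdn_leq//= leqNgt; apply/negP => /(H _ mn).
by rewrite prim_expr_order ?eqxx.
Qed.

Lemma order_unique (A : nzRingType) (x : A) m n :
  has_order x m -> has_order x n -> m = n.
Proof.
move=> hm hn; apply/eqP; rewrite eqn_dvd (prim_order_dvd hm) (prim_order_dvd hn).
by rewrite (prim_expr_order hm) (prim_expr_order hn) eqxx.
Qed.

Section Trace.
Context (F : numFieldType) (A : lalgType F).
Implicit Types (x : A).

Lemma lalg_mulrn_eq0 x n : (0 < n)%N -> x *+ n = 0 -> x = 0.
Proof.
move=> n0 /eqP; rewrite -scaler_nat scaler_eq0 pnatr_eq0 -[_ == _]negbK -lt0n n0.
by move=> /eqP.
Qed.

Lemma lalg_natr_neq0 n : (0 < n)%N -> n%:R != 0 :> A.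
Proof. by move=> n0; apply/eqP => /(lalg_mulrn_eq0 n0)/eqP; rewrite oner_eq0. Qed.

(** With y = x - 1 the equation says y ^+ 2 = 0, so x ^+ m = 1 + m y for every
    m, and x ^+ n = 1 forces n y = 0. *)
Lemma unipotent_finite_order x n :
  (0 < n)%N -> x ^+ n = 1 -> x ^+ 2 + 1 = x *+ 2 -> x = 1.
Proof.
move=> n0 xn1 xE; pose y := x - 1.
have xy : x = 1 + y by rewrite /y addrC subrK.
have y2 : y * y = 0.
  by rewrite -expr2 sqrrB1 addrAC xE subrr.
have powE m : x ^+ m = 1 + y *+ m.
  elim: m => [|m IH]; first by rewrite expr0 mulr0n addr0.
  rewrite exprS IH {1}xy mulrDl mul1r mulrDr mulr1 mulrnAr y2 mul0rn addr0.
  by rewrite -addrA mulrSr.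
have : y *+ n = 0 by apply: (addrI 1); rewrite -powE xn1 addr0.
by move=> /(lalg_mulrn_eq0 n0) y0; rewrite xy y0 addr0.
Qed.

Lemma unipotent_finite_orderN x n :
  (0 < n)%N -> x ^+ n = 1 -> x ^+ 2 + 1 = - (x *+ 2) -> x = -1.
Proof.
move=> n0 xn1 xE; apply: oppr_inj; rewrite opprK.
apply: (@unipotent_finite_order _ (n * 2)); rewrite ?muln_gt0 ?n0//.
  by rewrite mulnC exprM sqrrN -exprM mulnC exprM xn1 expr1n.
by rewrite sqrrN xE mulNrn.
Qed.

Lemma lalg_neq1 x n : (0 < n)%N -> (x = 1 -> n%:R = 0 :> A) -> x != 1.
Proof. by move=> n0 H; apply/eqP => /H/eqP; apply/negP; exact: lalg_natr_neq0. Qed.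

Lemma expr3_of_trace_N1 x : x ^+ 2 + 1 = - x -> x ^+ 3 = 1.
Proof.
move=> xE; have x2 : x ^+ 2 = - x - 1 by rewrite -xE addrK.
by rewrite exprS x2 mulrBr mulr1 mulrN -expr2 x2 opprB opprK addrK.
Qed.

Lemma primitive_root3 x : x ^+ 2 + 1 = - x -> 3.-primitive_root x.
Proof.
move=> xE; apply: primitive_root_least => //; first exact: expr3_of_trace_N1.
move=> [|[|[|d]]]// _ _; rewrite expr1; apply: (@lalg_neq1 _ 3) => // x1.
move: xE; rewrite x1 expr1n => /eqP.
by rewrite -addr_eq0 (natrD _ 2 1) => /eqP.
Qed.

Lemma primitive_root4 x : x ^+ 2 + 1 = 0 -> 4.-primitive_root x.
Proof.
move=> xE; have x2 : x ^+ 2 = -1 by rewrite -[LHS](addrK 1) xE add0r.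
apply: primitive_root_least => // [|[|[|[|[|d]]]]]//.
- by rewrite (exprM x 2 2) x2 sqrrN expr1n.
- by move=> _ _; rewrite expr1; apply: (@lalg_neq1 _ 2) => // x1; rewrite -[RHS]xE x1 expr1n.
- by move=> _ _; apply: (@lalg_neq1 _ 2) => // x1; rewrite -[RHS]xE x1.
Qed.

Lemma primitive_root6 x : x ^+ 2 + 1 = x -> 6.-primitive_root x.
Proof.
move=> xE; have x3 : x ^+ 3 = -1.
  (* The opposite of x satisfies the equation of trace -1. *)
  apply: oppr_inj; rewrite opprK -[RHS](@expr3_of_trace_N1 (- x)) ?sqrrN ?opprK//.
  by rewrite exprNn -signr_odd mulN1r.
apply: primitive_root_least => // [|[|[|[|[|[|[|d]]]]]]]//.
- by rewrite (exprM x 3 2) x3 sqrrN expr1n.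
- move=> _ _; rewrite expr1; apply: (@lalg_neq1 _ 1) => // x1.
  by move: xE; rewrite x1 expr1n -[RHS]addr0 => /addrI.
- move=> _ _; apply: (@lalg_neq1 _ 3) => // x2.
  have x2E : x = 2 by rewrite -xE x2.
  have : x ^+ 2 - 1 = 0 by rewrite x2 subrr.
  by rewrite x2E expr2 -natrM => /eqP; rewrite subr_eq0 -subr_eq0 (natrB _ (isT : 1 <= 4)%N) // => /eqP.
- move=> _ _; apply: (@lalg_neq1 _ 2) => // /eqP.
  by rewrite x3 -subr_eq0 -opprD oppr_eq0 => /eqP.
Qed.

Lemma primitive_rootN1 : 2.-primitive_root (-1 : A).
Proof.
apply: primitive_root_least => // [|[|[|d]]]//; first by rewrite sqrrN expr1n.
move=> _ _; apply: (@lalg_neq1 _ 2) => // /eqP.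
by rewrite expr1 -subr_eq0 -opprD oppr_eq0 => /eqP.
Qed.

Lemma primitive_root1 : 1.-primitive_root (1 : A).
Proof. by apply: primitive_root_least => // -[]. Qed.

Definition trace_orders : seq (F * nat) :=
  [:: (2, 1%N); (-2, 2%N); (1, 6%N); (-1, 3%N); (0, 4%N)].

(** The equation on x is the one that Cayley and Hamilton give for a matrix of
    determinant 1 and trace t.  For t = 1, -1, 0 its consequences x ^+ 3 = -1,
    x ^+ 3 = 1 and x ^+ 2 = -1 pin down the order; for t = 2, -2 finiteness of
    the order excludes the nontrivial unipotent elements and their opposites. *)
Lemma primitive_root_of_trace x (t : F) n k :
  (0 < n)%N -> x ^+ n = 1 -> x ^+ 2 + 1 = t *: x ->
  (t, k) \in trace_orders -> k.-primitive_root x.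
Proof.
move=> n0 xn1 + tk; move: tk; rewrite !inE => /or4P[||/eqP[-> ->]|/orP[]].
- move=> /eqP[-> ->]; rewrite scaler_nat.
  by move=> /(unipotent_finite_order n0 xn1) ->; exact: primitive_root1.
- move=> /eqP[-> ->]; rewrite scaleNr scaler_nat.
  by move=> /(unipotent_finite_orderN n0 xn1) ->; exact: primitive_rootN1.
- by rewrite scale1r; exact: primitive_root6.
- by move=> /eqP[-> ->]; rewrite scaleN1r; exact: primitive_root3.
- by move=> /eqP[-> ->]; rewrite scale0r; exact: primitive_root4.
Qed.
End Trace.

(** * Eigenvalues of a matrix of finite order *)

Lemma root_char_poly_expr1 (F : fieldType) n (g : 'M[F]_n.+1) (l : F) r :
  root (char_poly g) l -> g ^+ r = 1 -> l ^+ r = 1.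
Proof.
rewrite -eigenvalue_root_char => /eigenvalueP[v vg v0] gr.
have powE m : v *m g ^+ m = l ^+ m *: v.
  elim: m => [|m IH]; first by rewrite !expr0 mulmx1 scale1r.
  by rewrite exprSr mulmxA IH -scalemxAl vg scalerA -exprSr.
have := powE r; rewrite gr mulmx1 => /eqP; rewrite -subr_eq0 -{1}[v]scale1r -scalerBl.
by rewrite scaler_eq0 (negPf v0) orbF subr_eq0 => /eqP ->.
Qed.

Lemma eigenvalues2_sum_prod (R : realType) (g : 'M[R[i]]_2) l1 l2 : eigenvalues2 g l1 l2 ->
 [/\ l1 + l2 = \tr g, l1 * l2 = \det g, root (char_poly g) l1 & root (char_poly g) l2].
Proof.
move=> h; have := char_poly_det g; have := @char_poly_trace _ 2 g isT.
rewrite h /= !(coefM, big_ord_recr, big_ord0, coefB, coefX, coefC) /=.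
move=> h1 h2; split.
- by apply: oppr_inj; rewrite -h1; ring.
- by move: h2; rewrite sqrrN expr1n mul1r => <-; ring.
- by rewrite rootM root_XsubC eqxx.
- by rewrite rootM !root_XsubC eqxx orbT.
Qed.

Lemma Cayley_Hamilton2 (R : comNzRingType) (g : 'M[R]_2) (l1 l2 : R) :
  char_poly g = ('X - l1%:P) * ('X - l2%:P) -> g ^+ 2 + (l1 * l2)%:M = (l1 + l2) *: g.
Proof.
move=> h; have := Cayley_Hamilton g; rewrite h rmorphM /= !rmorphB /= horner_mx_X !horner_mx_C.
move/eqP; rewrite mulrBr !mulrBl -expr2 -!mulmxE mul_mx_scalar !mul_scalar_mx scale_scalar_mx opprB.
move=> /eqP e; apply/eqP; rewrite -subr_eq0 -e scalerDl; apply/eqP.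
by rewrite opprD !addrA; congr (_ + _); rewrite addrAC; congr (_ + _); rewrite addrAC.
Qed.

(** A root of unity has norm 1, so its inverse is its conjugate and the sum is
    twice the real part. *)
Lemma inverse_root_of_unity_sum (R : realType) (l l' : R[i]) r :
  (0 < r)%N -> l ^+ r = 1 -> l * l' = 1 ->
  exists2 c : R, l + l' = c%:C & -2 <= c <= 2.
Proof.
move=> r0 lr ll'; have l1 : `|l| = 1.
  by apply/eqP; rewrite -(@pexpr_eq1 _ _ r) // -normrX lr normr1.
have l0 : l != 0 by rewrite -normr_eq0 l1 oner_eq0.
have -> : l' = conjc l by apply: (mulfI l0); rewrite ll' -sqr_normc l1 expr1n.
exists (2 * complex.Re l); first by rewrite addcJ rmorphM rmorph_nat.
have := normc_ge_Re l; rewrite l1 -[1]/(1%:C) lecR ler_norml => /andP[h1 h2].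
by apply/andP; split; lra.
Qed.

Lemma int_between_N2_2 (R : realType) (c : R) :
  c \is a Num.int -> -2 <= c <= 2 -> c%:C \in [:: 2; -2; 1; -1; 0 : R[i]].
Proof.
move=> /intrP[m ->]; rewrite -[2]/(2%:~R) -rmorphN /= !ler_int => /andP[h1 h2].
rewrite rmorph_int.
have : m \in [:: 2; -2; 1; -1; 0] by rewrite !inE; lia.
rewrite !inE => /or4P[||/eqP->|/orP[]]; try by move=> /eqP ->; rewrite ?rmorphN ?eqxx ?orbT.
by rewrite eqxx !orbT.
Qed.

Lemma swap_of_sum_prod (F : fieldType) (x1 x2 y1 y2 : F) :
  x1 + x2 = y1 + y2 -> x1 * x2 = y1 * y2 -> eq_up_to_swap x1 x2 y1 y2.
Proof.
move=> es ep; have : (x1 - y1) * (x1 - y2) = 0.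
  have -> : (x1 - y1) * (x1 - y2) = x1 * (x1 + x2 - (y1 + y2)) - (x1 * x2 - y1 * y2).
    by ring.
  by rewrite es ep !subrr mulr0 subrr.
move/eqP; rewrite mulf_eq0 !subr_eq0 => /orP[] /eqP e; [left|right]; split=> //.
  by apply: (addrI x1); rewrite es e.
by apply: (addrI x1); rewrite es e addrC.
Qed.

Lemma sum_of_swap (V : nmodType) (x1 x2 y1 y2 : V) :
  eq_up_to_swap x1 x2 y1 y2 -> x1 + x2 = y1 + y2.
Proof. by case=> -[-> ->]; rewrite // addrC. Qed.

(** * The numbers exp (i pi / 3) and exp (2 i pi / 3) *)

(** Doubling the angle pi / 3 gives its supplement, so c = cos (pi / 3) solves
    2 c ^+ 2 - 1 = - c, whose only positive root is 1 / 2. *)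
Lemma cos_pi3 (R : realType) : cos (pi / 3 : R) = 1 / 2.
Proof.
have pi0 := pi_gt0 R.
have c0 : 0 < cos (pi / 3 : R) by apply: cos_gt0_pihalf; lra.
have e : cos (pi / 3 *+ 2 : R) = - cos (pi / 3).
  have -> : pi / 3 *+ 2 = - (pi / 3) + pi :> R by rewrite mulr2n; lra.
  by rewrite cosDpi cosN.
move: e; rewrite cos_mulr2n; move: (cos _) c0 => c c0 e.
have : (c + 1) * (c *+ 2 - 1) = 0.
  by apply: etrans (_ : (c ^+ 2 *+ 2 - 1) + c = 0); [ring | rewrite e; ring].
by move/eqP; rewrite mulf_eq0 => /orP[] /eqP; lra.
Qed.

Lemma cexpi_sum (R : realType) (t : R) : cexpi t + cexpi (- t) = (2 * cos t)%:C.
Proof. by rewrite /cexpi cosN sinN; apply/eqP; rewrite eq_complex /= subrr eqxx andbT mulr_natl mulr2n. Qed.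

Lemma cexpi_mul (R : realType) (t : R) : cexpi t * cexpi (- t) = 1.
Proof.
rewrite /cexpi cosN sinN; apply/eqP; rewrite eq_complex /= .
by apply/andP; split; apply/eqP; [rewrite -(cos2Dsin2 t)|]; ring.
Qed.

Lemma cexpi_pi3_sum (R : realType) :
  cexpi (pi / 3) + cexpi (- (pi / 3)) = 1 :> R[i].
Proof. by rewrite cexpi_sum cos_pi3 mulrC divfK ?pnatr_eq0. Qed.

Lemma cexpi_2pi3_sum (R : realType) :
  cexpi (2 * pi / 3) + cexpi (- (2 * pi / 3)) = -1 :> R[i].
Proof.
rewrite cexpi_sum; have -> : 2 * pi / 3 = - (pi / 3) + pi :> R by lra.
by rewrite cosDpi cosN cos_pi3 mulrN mulrC divfK ?pnatr_eq0// rmorphN.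
Qed.

(** * Trace and order in SL(2, End E) *)

Theorem proposition15 (R : realType) (S : set R[i])
    (hS : is_elliptic_End_ring S)
    (g : 'M[R[i]]_2) (hg : SL2 S g)
    (r : nat) (hr : has_order g r)
    (l1 l2 : R[i]) (hl : eigenvalues2 g l1 l2) :
  [/\ \tr g \in [:: 2; -2; 1; -1; 0],
      has_order l1 r /\ has_order l2 r,
      r \in [:: 1; 2; 3; 4; 6]%N
    & [/\ [<-> \tr g = 2;
               l1 = 1 /\ l2 = 1;
               g = 1%:M;
               has_order g 1],
          [<-> \tr g = -2;
               l1 = -1 /\ l2 = -1;
               g = - 1%:M;
               has_order g 2],
          [<-> \tr g = 1;
               eq_up_to_swap l1 l2 (cexpi (pi / 3)) (cexpi (- (pi / 3)));
               has_order g 6],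
          [<-> \tr g = -1;
               eq_up_to_swap l1 l2 (cexpi (2 * pi / 3)) (cexpi (- (2 * pi / 3)));
               has_order g 3]
        & [<-> \tr g = 0;
               eq_up_to_swap l1 l2 'i%C (- 'i%C);
               has_order g 4]]].
Proof.
have r0 := prim_order_gt0 hr; have gr := prim_expr_order hr.
have [sum_tr prod_det /root_char_poly_expr1-/(_ _ gr) l1r /root_char_poly_expr1-/(_ _ gr) l2r] :=
  eigenvalues2_sum_prod hl.
case: hg => Sg det1; rewrite det1 in prod_det.
have [c trc c2] := inverse_root_of_unity_sum r0 l1r prod_det.
have cint : c \is a Num.int.
  case: hS Sg => L [latL ->] Sg; apply: (real_multiplier_int latL) => l Ll.
  rewrite -trc sum_tr /mxtrace big_ord_recr big_ord_recr big_ord0 /= add0r mulrDl.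
  by apply: is_lattice_add => //; apply: End_ring_preserves_lattice.
have tr_mem : \tr g \in [:: 2; -2; 1; -1; 0].
  by rewrite -sum_tr trc; exact: int_between_N2_2.
have eqg : g ^+ 2 + 1 = \tr g *: g.
  by have := Cayley_Hamilton2 hl; rewrite prod_det sum_tr.
(* The eigenvalues live in the complex numbers as an algebra over themselves. *)
have eql1 : (l1 : R[i]^o) ^+ 2 + 1 = \tr g *: (l1 : R[i]^o).
  by rewrite -sum_tr -prod_det [_ *: _]mulrDl [l2 * _]mulrC expr2.
have eql2 : (l2 : R[i]^o) ^+ 2 + 1 = \tr g *: (l2 : R[i]^o).
  by rewrite -sum_tr -prod_det [_ *: _]mulrDl expr2 addrC.
have [n trn] : exists n, (\tr g, n) \in trace_orders R[i].
  have /mapP[[t n] tn /= tE] : \tr g \in map fst (trace_orders R[i]) by [].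
  by exists n; rewrite tE.
have gn : has_order g n := primitive_root_of_trace r0 gr eqg trn.
have rn : r = n := order_unique hr gn.
have trE k : has_order g k -> (\tr g, k) \in trace_orders R[i].
  by move=> /(order_unique hr) <-; rewrite rn.
have ordE t k : (t, k) \in trace_orders R[i] -> \tr g = t -> has_order g k.
  by move=> tk e; apply: (primitive_root_of_trace r0 gr eqg); rewrite e.
have g1 : \tr g = 2 -> g = 1.
  by move=> e; apply: (unipotent_finite_order r0 gr); rewrite eqg e scaler_nat.
have gN1 : \tr g = -2 -> g = -1.
  by move=> e; apply: (unipotent_finite_orderN r0 gr); rewrite eqg e scaleNr scaler_nat.
have swapE (t y1 y2 : R[i]) : y1 + y2 = t -> y1 * y2 = 1 -> \tr g = t ->
    eq_up_to_swap l1 l2 y1 y2.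
  by move=> ys yp e; apply: swap_of_sum_prod; rewrite ?yp// sum_tr e.
have swap_tr (t y1 y2 : R[i]) : y1 + y2 = t -> eq_up_to_swap l1 l2 y1 y2 -> \tr g = t.
  by move=> ys /sum_of_swap; rewrite sum_tr ys.
split => //.
- by rewrite rn; split; [exact: (primitive_root_of_trace r0 l1r eql1) |
                         exact: (primitive_root_of_trace r0 l2r eql2)].
- by move: trn; rewrite -rn !inE => /or4P[||/eqP[_ ->]|/orP[]]// /eqP[_ ->].
have sum6 := cexpi_pi3_sum R; have sum3 := cexpi_2pi3_sum R.
have sum4 : 'i%C + - 'i%C = 0 :> R[i] by rewrite subrr.
have prod4 : 'i%C * - 'i%C = 1 :> R[i] by rewrite mulrN -expr2 sqr_i opprK.
split.
- tfae.
  + by move=> e; have := swapE 2 1 1 erefl (mulr1 1) e; case.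
  + by case=> e1 e2; apply: g1; rewrite -sum_tr e1 e2.
  + by move=> ->; exact: primitive_root1.
  + by move=> /trE; rewrite !inE !xpair_eqE /= !andbF ?orbF andbT => /eqP.
- tfae.
  + move=> e; have := swapE (-2) (-1) (-1) _ _ e.
    by case; rewrite ?mulrNN ?mulr1 -?opprD//.
  + by case=> e1 e2; apply: gN1; rewrite -sum_tr e1 e2 -opprD.
  + by move=> ->; exact: primitive_rootN1.
  + by move=> /trE; rewrite !inE !xpair_eqE /= !andbF ?orbF andbT => /eqP.
- tfae.
  + exact: swapE sum6 (cexpi_mul _).
  + by move=> /(swap_tr _ _ _ sum6); apply: ordE; rewrite !inE eqxx !orbT.
  + by move=> /trE; rewrite !inE !xpair_eqE /= !andbF ?orbF andbT => /eqP.
- tfae.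
  + exact: swapE sum3 (cexpi_mul _).
  + by move=> /(swap_tr _ _ _ sum3); apply: ordE; rewrite !inE eqxx !orbT.
  + by move=> /trE; rewrite !inE !xpair_eqE /= !andbF ?orbF andbT => /eqP.
- tfae.
  + exact: swapE sum4 prod4.
  + by move=> /(swap_tr _ _ _ sum4); apply: ordE; rewrite !inE eqxx !orbT.
  + by move=> /trE; rewrite !inE !xpair_eqE /= !andbF ?orbF andbT => /eqP.
Qed.
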